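(* Let $(X,\mathcal{F})$ be a well-graded family with $\emptyset\in\mathcal{F}$ and additionality $r$ for some $r\in\mathbb{N}$. Let $U$ be a nonempty subset of the vertices of $G_{\mathcal{F}}$. Then $$|st(U)|+1\le|below(U)|\le|st(U)|+r.$$
   Context: A set system $(X,\mathcal{F})$ is a finite set $X$ together with a nonempty family $\mathcal{F}$ of distinct subsets of $X$. Its one-inclusion graph $G_{\mathcal{F}}$ has a vertex $v_A$ for each $A\in\mathcal{F}$, with an edge (directed from $v_A$ to $v_B$, labelled $b$) whenever $B=A\cup\{b\}$ for some $b\in X\setminus A$. The system is a well-graded family if for all $A,B\in\mathcal{F}$ the distance between $v_A$ and $v_B$ in the underlying undirected graph of $G_{\mathcal{F}}$ equals $|A\triangle B|$ (infinite distance if there is no path). $ess_{\mathcal{F}}(X)$ is the set of $x\in X$ for which there are $A,B\in\mathcal{F}$ with $x\in A$ and $x\notin B$; the additionality is $|\mathcal{F}|-|ess_{\mathcal{F}}(X)|$. For a vertex $v=v_A$ put $st(v)=A$. For a set $U$ of vertices of $G_{\mathcal{F}}$ put $st(U)=\bigcup_{v\in U}st(v)$ and $below(U)=\{v\in V(G_{\mathcal{F}}):\exists u\in U,\ st(v)\subseteq st(u)\}$. *)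

(* Defs.v *)
From mathcomp Require Import all_boot all_order all_algebra.

Set Implicit Arguments.
Unset Strict Implicit.
Unset Printing Implicit Defensive.

Section GraphDistance.
Variable V : eqType.

Definition walk (e : rel V) (x y : V) (p : seq V) : bool :=
  path e x p && (last x p == y).

(* [dist_eq e x y d] never holds when there is no walk from x to y (infinite
   distance); [size p] is the number of edges of the walk x :: p. *)
Definition dist_eq (e : rel V) (x y : V) (d : nat) : Prop :=
  (exists2 p, walk e x y p & size p = d) /\
  (forall p, walk e x y p -> d <= size p).

End GraphDistance.

(* The finite ground set X is the whole finite type T; families of distinct
   subsets are elements of {set {set T}}. *)
Section SetSystems.
Variable T : finType.

Definition symdiff (A B : {set T}) : {set T} := (A :\: B) :|: (B :\: A).

Definition vertex (F : {set {set T}}) : finType := {A : {set T} | A \in F}.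

Definition ess (F : {set {set T}}) : {set T} :=
  [set x | [exists A in F, exists B in F, (x \in A) && (x \notin B)]].

(* Subtraction in int: truncated subtraction on nat would identify every
   negative value with 0. *)
Definition additionality (F : {set {set T}}) : int :=
  (#|F|%:Z - #|ess F|%:Z)%R.

Variable F : {set {set T}}.

Definition st (v : vertex F) : {set T} := val v.

Definition labelled_edge (b : T) (u v : vertex F) : bool :=
  (b \notin st u) && (st v == b |: st u).

Definition one_inclusion : rel (vertex F) :=
  [rel u v | [exists b, labelled_edge b u v]].

Definition one_inclusion_undirected : rel (vertex F) :=
  [rel u v | one_inclusion u v || one_inclusion v u].

Definition well_graded : Prop :=
  F != set0 /\
  forall u v : vertex F,
    dist_eq one_inclusion_undirected u v #|symdiff (st u) (st v)|.

Definition st_set (U : {set vertex F}) : {set T} := \bigcup_(v in U) st v.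

Definition below (U : {set vertex F}) : {set vertex F} :=
  [set v | [exists u in U, st v \subset st u]].

End SetSystems.

(* Main.v *)
Require Import Defs.
From mathcomp Require Import all_boot all_order all_algebra.

(** Well-gradedness together with the empty set makes the family accessible:
    the first step of a shortest walk from a nonempty [A] to the empty set
    deletes an element of [A]. Hence, when the members of a family are added in
    order of increasing cardinality, each one contributes at most one new point
    to the union. Growing from the empty set to [below U] gives the lower bound,
    and growing from [below U] to [F] gives the upper bound. *)

Lemma card_cover_accessible (T : finType) (D E : {set {set T}}) :
    D \subset E ->
    (forall A, A \in E :\: D -> exists2 a, a \in A & A :\ a \in E) ->
  #|cover E| + #|D| <= #|cover D| + #|E|.
Proof.
elim/ltn_ind: {E}#|E| {-2}E (erefl #|E|) => n IHn E cardE sDE accE.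
have [ED0 | [A0 A0ED]] := set_0Vmem (E :\: D).
  have /eqP -> : D == E by rewrite eqEsubset sDE -setD_eq0 ED0 eqxx.
  by [].
have [A AED maxA] : {A | A \in E :\: D & forall B, B \in E :\: D -> #|B| <= #|A|}.
  by case: (arg_maxnP (fun B : {set T} => #|B|) A0ED) => A; exists A.
have [a aA AaE] := accE A AED.
move: (AED); rewrite inE => /andP[AnD AE].
have cardE' : #|E| = #|E :\ A|.+1 by rewrite (cardsD1 A) AE.
have AaE' : A :\ a \in E :\ A.
  rewrite !inE AaE andbT; apply/eqP => /setP/(_ a).
  by rewrite !inE eqxx aA.
have sDE' : D \subset E :\ A by rewrite subsetD1 sDE.
(* Removing a largest [A] keeps accessibility, as [B :\ b] is smaller than [A]. *)
have accE' B : B \in (E :\ A) :\: D -> exists2 b, b \in B & B :\ b \in E :\ A.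
  rewrite !inE => /and3P[BnD BA BE].
  have BED : B \in E :\: D by rewrite inE BnD.
  have [b bB BbE] := accE B BED; exists b => //.
  rewrite !inE BbE andbT; apply/eqP => eqA.
  by have := maxA B BED; rewrite (cardsD1 b) bB eqA /= ltnn.
have le_n : #|E :\ A| < n by rewrite -cardE cardE'.
have := IHn _ le_n (E :\ A) erefl sDE' accE'.
(* Only [a] can be lost from the union, since [A :\ a] is still a member of [E :\ A]. *)
have coverE : cover E \subset a |: cover (E :\ A).
  apply/subsetP => x /bigcupP[B BE xB]; rewrite in_setU1.
  have [//|/= xa] := eqVneq x a; apply/bigcupP.
  have [eqBA | BA] := eqVneq B A; last by exists B => //; rewrite !inE BA.
  by exists (A :\ a) => //; rewrite !inE xa -eqBA.
have le_cover : #|cover E| <= #|cover (E :\ A)|.+1.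
  apply: leq_trans (subset_leq_card coverE) _.
  by rewrite cardsU1 -add1n leq_add2r leq_b1.
move=> IH; rewrite cardE' addnS.
by apply: leq_trans (leq_add le_cover (leqnn _)) _; rewrite addSn ltnS.
Qed.

Lemma well_graded_accessible (T : finType) (F : {set {set T}}) :
    well_graded F -> set0 \in F ->
  forall A, A \in F -> A != set0 -> exists2 a, a \in A & A :\ a \in F.
Proof.
move=> [_ distF] F0 A FA A0.
pose o : vertex F := Sub set0 F0; pose u : vertex F := Sub A FA.
have symdiff0 (v : vertex F) : symdiff (st v) (st o) = st v.
  by rewrite /symdiff /st SubK setD0 set0D setU0.
have [[p wp sp] _] := distF u o.
case: p wp sp => [|v p] /andP[/= pth lst] sp.
  by move: lst A0 => /eqP/(congr1 val) /= ->; rewrite eqxx.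
move: pth => /andP[euv pth].
(* The whole walk has length [#|A|], and its tail [p] joins [v] to [o], so it is at least as long as
   their distance [#|st v|]. *)
have cardv : #|st v| < #|A|.
  have [_ mind] := distF v o.
  rewrite -[A]/(st u) -(symdiff0 u) -sp ltnS -(symdiff0 v).
  by apply: mind; rewrite /walk pth.
move: euv; rewrite /one_inclusion_undirected /one_inclusion /=.
(* An edge directed from [u] to [v] would enlarge the set, against [cardv]; hence [v] is [A] with
   [b] deleted. *)
case/orP => /existsP[b /andP[bn /eqP eqb]].
  by move: cardv; rewrite eqb cardsU1 bn add1n -[st u]/A ltnNge leqnSn.
move: eqb; rewrite -[st u]/A => ->.
exists b; first exact: setU11.
by rewrite setU1K //; exact: valP.
Qed.

(** The empty set serves as the member that omits [x], whatever [x] is. *)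
Lemma ess_cover (T : finType) (F : {set {set T}}) :
  set0 \in F -> ess F = cover F.
Proof.
move=> F0; apply/setP => x; rewrite inE; apply/existsP/bigcupP.
  by case=> A /andP[FA /existsP[B /and3P[_ xA _]]]; exists A.
case=> A FA xA; exists A; rewrite FA; apply/existsP; exists set0.
by rewrite F0 xA inE.
Qed.

Lemma cover_below (T : finType) (F : {set {set T}}) (U : {set vertex F}) :
  cover [set val v | v in below U] = st_set U.
Proof.
apply/setP => x; apply/bigcupP/bigcupP.
  case=> B /imsetP[v]; rewrite inE => /existsP[u /andP[uU vu]] -> xv.
  by exists u => //; apply: (subsetP vu).
case=> u uU xu; exists (val u) => //; apply/imsetP; exists u => //.
by rewrite inE; apply/existsP; exists u; rewrite uU subxx.
Qed.

(** Transitivity of inclusion. This lets [below U] inherit accessibility from [F]. *)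
Lemma below_subset_closed (T : finType) (F : {set {set T}})
    (U : {set vertex F}) (A B : {set T}) :
    A \in [set val v | v in below U] -> B \in F -> B \subset A ->
  B \in [set val v | v in below U].
Proof.
case/imsetP=> v; rewrite inE => /existsP[u /andP[uU vu]] -> FB sBv.
apply/imsetP; exists (Sub B FB); last by rewrite SubK.
rewrite inE; apply/existsP; exists u; rewrite uU /st SubK.
exact: subset_trans sBv vu.
Qed.

Theorem lemma3p4 (T : finType) (F : {set {set T}}) (r : nat)
    (hF : well_graded F) (h0 : set0 \in F) (hr : additionality F = r%:Z%R)
    (U : {set vertex F}) (hU : U != set0) :
  #|st_set U| + 1 <= #|below U| /\ #|below U| <= #|st_set U| + r.
Proof.
have accF := well_graded_accessible _ _ hF h0.
rewrite -(cover_below _ F U) -(card_imset (below U) val_inj).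
set D := [set val v | v in below U].
have sDF : D \subset F by apply/subsetP => _ /imsetP[v _ ->]; exact: valP.
have D0 : set0 \in D.
  have [u uU] := set0Pn _ hU.
  apply: (below_subset_closed _ _ _ (val u)) => //; last exact: sub0set.
  apply/imsetP; exists u => //.
  by rewrite inE; apply/existsP; exists u; rewrite uU subxx.
split.
  (* The starting family has one member and empty union, which accounts for the [+ 1]. *)
  have := card_cover_accessible _ [set set0] D.
  rewrite sub1set /cover big_set1 cards0 cards1; apply=> //.
  move=> A; rewrite !inE => /andP[A0 AD].
  have [a aA FAa] := accF A (subsetP sDF _ AD) A0; exists a => //.
  exact: below_subset_closed AD FAa (subD1set _ _).
have cardF : #|F| = r + #|cover F|.
  move/eqP: hr; rewrite /additionality GRing.subr_eq ess_cover //.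
  by rewrite -PoszD => /eqP[].
(* Adding [#|cover F|] to both sides turns [r] into [#|F|], giving the counting inequality for [D]
   inside [F]. *)
rewrite -(leq_add2l #|cover F|) addnCA (addnC _ r) -cardF.
apply: card_cover_accessible => // A; rewrite inE => /andP[AnD FA].
(* A member outside [D] is nonempty because [set0] lies in [D]. *)
by apply: accF => //; apply: contraNneq AnD => ->.
Qed.
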